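(* There is an absolute constant $C>0$ such that for every metrical task system $(\mathcal{X},\mathcal{L})$ with $|\mathcal{X}|=N$ and $D=\max_{x,y\in\mathcal{X}}d(x,y)$, and every time horizon $T\ge 1$, there is an online algorithm whose regret on every time interval $I\subseteq\{1,\dots,T\}$ is at most $C\sqrt{(D+1)\,|I|\,\log(NT)}$.
   Context: Metrical task system (MTS): a pair $(\mathcal{X},\mathcal{L})$ where $\mathcal{X}$ is an $N$-point (pseudo-)metric space with distance $d$ (its points are called states) and $\mathcal{L}\subseteq[0,1]^{\mathcal{X}}$ is a collection of possible loss vectors. At each step $t=1,\dots,T$ the (possibly randomized) online algorithm is first given a loss vector $l_t\in\mathcal{L}$ and then chooses a state $i_t\in\mathcal{X}$; it pays $l_t(i_t)$ and, for $t\ge 2$, a movement cost $d(i_t,i_{t-1})$. The loss sequence is fixed in advance (oblivious adversary) and $T$ is known to the algorithm. Time interval: a set $I=\{t_0+1,\dots,t_0+k\}\subseteq\{1,\dots,T\}$ of consecutive steps, $|I|=k$. The regret on $I$ is the smallest $R(I)$ such that for every loss sequence in $\mathcal{L}$ $$\mathbb{E}\Big[\sum_{t\in I} l_t(i_t)+\sum_{t\in I\setminus\{t_0+1\}}d(i_t,i_{t-1})\Big]\le\min_{x\in\mathcal{X}}\sum_{t\in I}l_t(x)+R(I).$$ *)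

(* Defs.v *)
From mathcomp Require Import all_boot all_order all_algebra.
From mathcomp Require Import all_classical all_reals all_analysis.
Set Implicit Arguments.
Unset Strict Implicit.
Unset Printing Implicit Defensive.
Import Order.TTheory GRing.Theory Num.Theory.
Local Open Scope classical_set_scope.
Local Open Scope ring_scope.

Record mts (R : realType) := Mts {
  state :> finType;
  state_gt0 : (0 < #|state|)%N;
  dist : state -> state -> R;
  dist_ge0 : forall x y, 0 <= dist x y;
  distxx : forall x, dist x x = 0;
  distC : forall x y, dist x y = dist y x;
  dist_triangle : forall x y z, dist x z <= dist x y + dist y z;
  losses : set (state -> R);
  losses_01 : losses `<=` [set l | forall x, 0 <= l x <= 1] }.

Definition diameter (R : realType) (M : mts R) : R :=
  \big[Num.max/0]_(p : M * M) dist p.1 p.2.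

(* [next_law ls past] is the conditional law of the next state once the loss  *)
(* vectors [ls] have been revealed and the states [past] have been visited.   *)
(* As there are finitely many states, such behavioural strategies cover every *)
(* randomized algorithm. At step [t], [ls] ends with the current loss vector, *)
(* so it is one longer than [past].                                           *)
Record online_algorithm (R : realType) (M : mts R) := OnlineAlgorithm {
  next_law :> seq (M -> R) -> seq M -> M -> R;
  next_law_ge0 : forall ls past x, 0 <= next_law ls past x;
  next_law_sum1 : forall ls past, \sum_(x : M) next_law ls past x = 1 }.

(* Steps are numbered from 0: the interval {t0+1, ..., t0+k} is the set of    *)
(* t : 'I_T with t0 <= t < t0 + k.                                            *)
Section Regret.
Context {R : realType} {M : mts R} (A : online_algorithm M) {T : nat}.
Implicit Types (l : T.-tuple (M -> R)) (w : T.-tuple M) (k : nat).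

Definition trajectory_prob l w : R :=
  \prod_(t < T) A (take t.+1 l) (take t w) (tnth w t).

Definition expected l (f : T.-tuple M -> R) : R :=
  \sum_(w : T.-tuple M) trajectory_prob l w * f w.

(* In the movement cost 0 < t, so [ord_pred t] does not wrap around. *)
Definition cost (t0 : nat) k l w : R :=
  \sum_(t < T | (t0 <= t < t0 + k)%N) tnth l t (tnth w t) +
  \sum_(t < T | (t0 < t < t0 + k)%N) dist (tnth w t) (tnth w (ord_pred t)).

(* The infimum ranges over a finite nonempty set: it is a minimum. *)
Definition best_static_cost (t0 : nat) k l : R :=
  inf (range (fun x : M => \sum_(t < T | (t0 <= t < t0 + k)%N) tnth l t x)).

Definition regret_bound (t0 : nat) k (r : R) : Prop :=
  forall l, (forall t, losses (tnth l t)) ->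
    expected l (cost t0 k l) <= best_static_cost t0 k l + r.

(* The least regret bound; it is -oo when no loss vector is possible. *)
Definition regret (t0 : nat) k : \bar R :=
  ereal_inf [set r%:E | r in regret_bound t0 k].

End Regret.
Arguments regret {R M} A T t0 k.

(* Main.v *)
(* Write K = D + 1 and lam = log (N T). It is enough to choose laws p_t on the *)
(* states from the losses up to time t: a maximal coupling of successive laws  *)
(* turns them into a randomized algorithm whose expected movement is at most   *)
(* D |p_t - p_(t-1)|_1. Start from a constant state and, for the rates         *)
(* eta = 2^-i / (32 K) from the slowest (i = J, with 2^J about T) to the       *)
(* fastest (i = 0), let multiplicative weights combine the previous algorithm  *)
(* [a] with the N constant states. Each state is charged an extra 16 K eta per *)
(* step; as the weights move by O(eta) times the weight not held by [a], this  *)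
(* pays for all movement. On an interval I the combination thus costs          *)
(* O(lam / eta) more than [a], up to negligible mixing errors, and             *)
(* O(lam / eta + K eta |I|) more than any state. For |I| about 4^i K lam the   *)
(* comparison with states is made at level i, and the faster levels only add   *)
(* a geometric sum of terms lam / eta.                                         *)

Require Import Defs.
From mathcomp Require Import all_boot all_order all_algebra.
From mathcomp Require Import all_classical all_reals all_analysis.
From mathcomp Require Import ring lra.
Import Order.TTheory GRing.Theory Num.Theory.
Local Open Scope ring_scope.

(** * Laws and multiplicative weights *)

(** Two facts drive the bound. First, multiplicative weights with the log-weight as potential give a
    per-step inequality ([mw_update_regret]) whose potential terms telescope over any interval;
    mixing with the uniform law keeps every log-weight above a fixed floor, so whatever happened
    before the interval costs at most that floor divided by eta. Second, the expert that follows the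
    previous algorithm [a] has relative loss 0. It therefore has no second-order term, and the
    weights move only in proportion to the mass S off [a] ([mw_update_l1]). A penalty proportional
    to eta on the constant states pays for exactly this movement ([combine_step_cost]).

    Thus one combination loses to [a] a term independent of the interval length, apart from mixing,
    and to a state an additional O((D+1) eta) per step ([combine_step_regret_base],
    [combine_step_regret_state]). Iterating over dyadic rates gives [multiscale_regret]: a geometric
    sum of interval-independent terms, plus the per-step term of whichever rate is chosen in the
    analysis. Choosing it by the length of the interval yields the square root
    ([multiscale_tuned_regret]). The passage from laws to states is [expected_cost_le]: successive
    laws are coupled maximally, so that the state at each step has the prescribed law. *)

Lemma ln_le_subr1 (R : realType) (u : R) : 0 < u -> ln u <= u - 1.
Proof. by move=> u0; rewrite -{1}[u](subrKC 1); apply: le_ln1Dx; lra. Qed.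

(** Apply [ln_le_subr1] at 1/(1-y); what remains is y^2 (1-2y) >= 0. *)
Lemma ln1B_ge (R : realType) (y : R) : y <= 1/2 -> - y - 2 * y ^+ 2 <= ln (1 - y).
Proof.
move=> y2; have y1 : 0 < 1 - y by lra.
have : ln (1 - y)^-1 <= (1 - y)^-1 - 1 by apply: ln_le_subr1; rewrite invr_gt0.
rewrite lnV ?posrE// -div1r.
suff : 1 / (1 - y) - 1 <= y + 2 * y ^+ 2 by lra.
rewrite lerBlDr ler_pdivrMr//.
have y0 : 0 <= y ^+ 2 by apply: sqr_ge0.
have : 0 <= y ^+ 2 * (1 - 2 * y) by apply: mulr_ge0; lra.
by rewrite !expr2 in y0 *; nra.
Qed.

Lemma sum_option (V : nmodType) (X : finType) (F : option X -> V) :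
  \sum_e F e = F None + \sum_x F (Some x).
Proof.
rewrite (bigD1 None)//=; congr (_ + _).
rewrite (reindex_omap Some id) => /=; last by case.
by apply: eq_bigl => x; rewrite eqxx.
Qed.

Section Laws.
Context {R : realType}.

Definition is_law (E : finType) (p : E -> R) :=
  (forall e, 0 <= p e) /\ \sum_e p e = 1.

Definition l1_dist (E : finType) (p q : E -> R) : R := \sum_e `|p e - q e|.

Lemma is_law_le1 (E : finType) (p : E -> R) e : is_law E p -> p e <= 1.
Proof.
move=> [p0 <-]; rewrite (bigD1 e)//= lerDl.
by apply: sumr_ge0 => *.
Qed.

Lemma is_law_card_gt0 (E : finType) (p : E -> R) : is_law E p -> (0 < #|E|)%N.
Proof.
move=> [_ p1]; apply/card_gt0P.
case: (pickP E) => [e|E0]; first by exists e.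
by move/eqP: p1; rewrite big_pred0// eq_sym oner_eq0.
Qed.

Lemma is_law_uniform (E : finType) : (0 < #|E|)%N -> is_law E (fun=> #|E|%:R^-1).
Proof.
move=> E0; split=> [e|]; first by rewrite invr_ge0.
by rewrite sumr_const -[LHS]mulr_natr mulVf// pnatr_eq0 -lt0n.
Qed.

Lemma is_law_mean_bound (E : finType) (p f : E -> R) a b :
  is_law E p -> (forall e, a <= f e <= b) -> a <= \sum_e p e * f e <= b.
Proof.
move=> [p0 p1] fab; rewrite -[a]mul1r -[b]mul1r -p1 !mulr_suml.
by apply/andP; split; apply: ler_sum => e _; rewrite ler_wpM2l//; case/andP: (fab e).
Qed.

Lemma l1_dist_ge0 (E : finType) (p q : E -> R) : 0 <= l1_dist E p q.
Proof. by apply: sumr_ge0 => e _. Qed.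

End Laws.
Arguments is_law {R E} p.
Arguments l1_dist {R E} p q.

Section MultiplicativeWeights.
Context {R : realType} {E : finType}.
Variables (eta gamma : R) (P r : E -> R).

(* A first-order multiplicative step against the relative losses [r], followed *)
(* by mixing with the uniform law at rate [gamma], which bounds weights below. *)
Definition mw_update (e : E) : R :=
  (1 - gamma) * (P e * (1 - eta * r e) / (1 - eta * \sum_i P i * r i)) +
  gamma / #|E|%:R.

Hypothesis lawP : is_law P.
Hypothesis r2 : forall e, -2 <= r e <= 2.
Hypothesis eta_bd : 0 < eta <= 1/32.
Hypothesis gamma_bd : 0 < gamma <= 1/2.

Local Notation M := (\sum_i P i * r i).
Local Notation Z := (1 - eta * M).

Let M2 : -2 <= M <= 2.
Proof. exact: is_law_mean_bound. Qed.

Let Z_ge : 1/2 <= Z.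
Proof.
have [m1 m2] := andP M2; have [e1 e2] := andP eta_bd.
have := ler_wpM2l (ltW e1) m2; lra.
Qed.

Let Z_gt0 : 0 < Z.
Proof. by move: Z_ge; lra. Qed.

Let factor_gt0 e : 0 < 1 - eta * r e.
Proof.
have [m1 m2] := andP (r2 e); have [e1 e2] := andP eta_bd.
have := ler_wpM2l (ltW e1) m2; lra.
Qed.

Let u e := P e * (1 - eta * r e) / Z.

Let u_ge0 e : 0 <= u e.
Proof. by rewrite !mulr_ge0 ?invr_ge0 ?(ltW (factor_gt0 _)) ?(ltW Z_gt0)//; case: lawP. Qed.

Let u_sum1 : \sum_e u e = 1.
Proof.
rewrite -mulr_suml -[RHS](@divff _ Z) ?gt_eqF//; congr (_ / _).
rewrite mulr_sumr -[X in X - _](proj2 lawP) -sumrB.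
by apply: eq_bigr => e _; ring.
Qed.

Lemma mw_update_floor e : gamma / #|E|%:R <= mw_update e.
Proof.
rewrite /mw_update lerDr mulr_ge0 ?u_ge0//; move: gamma_bd; lra.
Qed.

Lemma mw_update_law : is_law mw_update.
Proof.
have [_ U1] := @is_law_uniform R E (is_law_card_gt0 _ _ lawP).
split=> [e|].
  apply: (le_trans _ (mw_update_floor e)).
  by rewrite mulr_ge0//; case/andP: gamma_bd => /ltW.
rewrite big_split/= -!mulr_sumr U1 (u_sum1); ring.
Qed.

(** Before mixing, an entry changes by (eta/Z) P e (M - r e), with 1/Z <= 2 and |M| at most the mean
    of |r|. Bounding by the mean of |r|, rather than by its maximum, is what makes experts with r =
    0 free. *)
Lemma mw_update_l1 :
  l1_dist mw_update P <= 4 * eta * \sum_e P e * `|r e| + 2 * gamma.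
Proof.
have [_ U1] := @is_law_uniform R E (is_law_card_gt0 _ _ lawP).
have [P0 P1] := lawP.
have gamma0 : 0 <= gamma by case/andP: gamma_bd => /ltW.
have eta0 : 0 <= eta by case/andP: eta_bd => /ltW.
have iZ0 : 0 <= Z^-1 by rewrite invr_ge0 ltW.
have iZ : Z^-1 <= 2 by rewrite -[2]invrK lef_pV2 ?posrE//; move: Z_ge; lra.
have [S SE] : exists S, S = \sum_e P e * `|r e| by eexists.
rewrite -SE.
have MS : `|M| <= S.
  rewrite SE; apply: le_trans (ler_norm_sum _ _ _) _; apply: ler_sum => e _.
  by rewrite normrM (ger0_norm (P0 e)).
have uP : \sum_e `|u e - P e| <= 4 * eta * S.
  have -> : \sum_e `|u e - P e| = \sum_e (eta / Z) * (P e * `|M - r e|).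
    apply: eq_bigr => e _.
    have -> : u e - P e = eta / Z * (P e * (M - r e)).
      by rewrite /u; move: Z_gt0; move: M => m ?; field; rewrite gt_eqF.
    by rewrite !normrM (ger0_norm (P0 e)) (ger0_norm eta0) normfV (gtr0_norm Z_gt0).
  rewrite -mulr_sumr.
  have h : \sum_e P e * `|M - r e| <= 2 * S.
    apply: (@le_trans _ _ (\sum_e (P e * `|M| + P e * `|r e|))).
      apply: ler_sum => e _; rewrite -mulrDr ler_wpM2l//.
      exact: ler_normB.
    by rewrite big_split/= -mulr_suml P1 mul1r -SE mulr_natl mulr2n lerD2r.
  have S0 : 0 <= S by apply: le_trans MS.
  apply: (@le_trans _ _ (eta / Z * (2 * S))).
    by apply: ler_wpM2l => //; apply: mulr_ge0.
  by have := ler_wpM2l (mulr_ge0 eta0 S0) iZ; move: (Z^-1) => z; lra.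
apply: (@le_trans _ _ (\sum_e (`|u e - P e| + (gamma * u e + gamma / #|E|%:R)))).
  apply: ler_sum => e _; rewrite /mw_update -/(u e).
  have -> : (1 - gamma) * u e + gamma / #|E|%:R - P e =
     (u e - P e) + (gamma / #|E|%:R - gamma * u e) by ring.
  apply: le_trans (ler_normD _ _) _; rewrite lerD2l.
  apply: le_trans (ler_normB _ _) _.
  have g1 : 0 <= gamma / #|E|%:R by rewrite divr_ge0.
  have g2 : 0 <= gamma * u e by rewrite mulr_ge0.
  by rewrite (ger0_norm g1) (ger0_norm g2) addrC.
rewrite !big_split/= -!mulr_sumr U1 u_sum1 !mulr1.
by rewrite [2 * gamma]mulr_natl mulr2n lerD2r.
Qed.

(** The gain in log-weight is at least ln (1 - gamma) + ln (1 - eta r) - ln Z, and ln Z <= -eta M;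
    dividing by eta gives the claim. *)
Lemma mw_update_regret e : 0 < P e ->
  M <= r e + 2 * eta * r e ^+ 2 + 4 * (gamma / eta) +
       (ln (mw_update e) - ln (P e)) / eta.
Proof.
move=> Pe; have [eta0 eta1] := andP eta_bd; have [gamma0 gamma1] := andP gamma_bd.
have g1 : 0 < 1 - gamma by lra.
have := mw_update_law => -[Q0 _].
have lnQ : ln (1 - gamma) + ln (P e) + ln (1 - eta * r e) - ln Z <= ln (mw_update e).
  rewrite -lnM ?posrE// -lnM ?posrE ?mulr_gt0// -ln_div ?posrE ?mulr_gt0//.
  have v0 : 0 < (1 - gamma) * P e * (1 - eta * r e) / Z.
    by rewrite divr_gt0// !mulr_gt0.
  have vQ : (1 - gamma) * P e * (1 - eta * r e) / Z <= mw_update e.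
    rewrite /mw_update !mulrA lerDl mulr_ge0 ?invr_ge0//; lra.
  by rewrite ler_ln// posrE// (lt_le_trans v0 vQ).
have lng : - 4 * gamma <= ln (1 - gamma).
  by have := ln1B_ge _ _ gamma1; rewrite expr2; nra.
have lnr : - (eta * r e) - 2 * (eta * r e) ^+ 2 <= ln (1 - eta * r e).
  apply: ln1B_ge; have [_ m2] := andP (r2 e).
  by have := ler_wpM2l (ltW eta0) m2; lra.
have lnZ : ln Z <= - (eta * M) by apply: le_trans (ln_le_subr1 _ _ Z_gt0) _; lra.
rewrite -(ler_pM2l eta0) [X in _ <= X](_ : _ = eta * r e + 2 * (eta * r e) ^+ 2 +
   4 * gamma + (ln (mw_update e) - ln (P e))); last by field; rewrite gt_eqF.
lra.
Qed.

End MultiplicativeWeights.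

(** * Combining an algorithm with the constant states *)

Section Combine.
Context {R : realType} {X : finType}.
Variable D : R.
Hypothesis D_ge0 : 0 <= D.

(* A fractional algorithm maps the losses seen so far, newest first, to a law *)
(* on the states.                                                             *)
Local Notation fractional := (seq (X -> R) -> X -> R).

(** An online algorithm must return laws on every input, even on losses outside [0,1]; clipping
    keeps the relative losses bounded there and changes nothing on admissible losses. *)
Definition clip (x : R) : R := Num.max 0 (Num.min 1 x).

Lemma clip_itv x : 0 <= clip x <= 1.
Proof. by rewrite /clip le_max lexx ge_max ler01 ge_min lexx. Qed.

Lemma clip_id x : 0 <= x <= 1 -> clip x = x.
Proof. by move=> /andP[x0 x1]; rewrite /clip (min_idPr x1) (max_idPr x0). Qed.

(** The l1 term dominates the expected movement under a maximal coupling of the two laws. *)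
Definition step_cost (p : fractional) (h : seq (X -> R)) (l : X -> R) : R :=
  \sum_x p (l :: h) x * clip (l x) + D * l1_dist (p (l :: h)) (p h).

Definition constant (x0 : X) : fractional := fun _ x => (x == x0)%:R.

Lemma constant_law x0 h : is_law (constant x0 h).
Proof.
split=> [x|]; first by rewrite ler0n.
by rewrite (bigD1 x0)//= {1}/constant eqxx big1 ?addr0// => x /negbTE xx0; rewrite /constant xx0.
Qed.

Lemma constant_l1 x0 h h' : l1_dist (constant x0 h) (constant x0 h') = 0.
Proof. by rewrite /l1_dist big1// => x _; rewrite subrr normr0. Qed.

Lemma constant_step_cost x0 h l : step_cost (constant x0) h l = clip (l x0).
Proof.
rewrite /step_cost constant_l1 mulr0 addr0 (bigD1 x0)//= {1}/constant eqxx mul1r.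
by rewrite big1 ?addr0// => x /negbTE xx0; rewrite /constant xx0 mul0r.
Qed.

Section Step.
Variables (eta rho : R) (a : fractional).

(* Charging every state a penalty proportional to [eta] pays for the movement *)
(* caused by the changes of the weights, while following [a] stays free.      *)
Definition excess (h : seq (X -> R)) (l : X -> R) (e : option X) : R :=
  if e is Some x then clip (l x) + 16 * (D + 1) * eta - step_cost a h l else 0.

Fixpoint weights (h : seq (X -> R)) : option X -> R :=
  if h is l :: h' then mw_update eta (rho * eta) (weights h') (excess h' l)
  else fun=> #|{: option X}|%:R^-1.

Definition combine : fractional := fun h x =>
  weights h (Some x) + weights h None * a h x.

Hypothesis eta_bd : 0 < eta <= (32 * (D + 1))^-1.
Hypothesis rho_bd : 0 < rho <= 1/8.
Hypothesis a_law : forall h, is_law (a h).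
Hypothesis a_move : forall h l, D * l1_dist (a (l :: h)) (a h) <= 1.

Let eta_gt0 : 0 < eta.
Proof. by case/andP: eta_bd. Qed.

Let etaD : 32 * (D + 1) * eta <= 1.
Proof.
have [_] := andP eta_bd.
by rewrite -[(_)^-1]div1r ler_pdivlMr ?mulr_gt0// 1?mulrC//; move: D_ge0; lra.
Qed.

Let eta_le : 0 < eta <= 1/32.
Proof.
rewrite eta_gt0/=; have := mulr_ge0 D_ge0 (ltW eta_gt0).
by move: etaD; lra.
Qed.

Let gamma_bd : 0 < rho * eta <= 1/2.
Proof.
have [r0 r1] := andP rho_bd; have [e0 e1] := andP eta_le.
by rewrite mulr_gt0//=; have := ler_pM (ltW r0) (ltW e0) r1 e1; lra.
Qed.

Let base_cost_bd h l : 0 <= step_cost a h l <= 2.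
Proof.
have := is_law_mean_bound X _ (clip \o l) _ _ (a_law (l :: h)) (fun x => clip_itv (l x)).
move=> /andP[m0 m1]; have v0 : 0 <= D * l1_dist (a (l :: h)) (a h).
  by rewrite mulr_ge0// l1_dist_ge0.
have v1 := a_move h l; rewrite /step_cost.
move: v0 v1 m0 m1 => /=; set v := D * _; set m := \sum_x _; lra.
Qed.

Let excess_bd h l e : -2 <= excess h l e <= 2.
Proof.
case: e => [x|]; last by rewrite /=; lra.
have [c0 c1] := andP (clip_itv (l x)); have [b0 b1] := andP (base_cost_bd h l).
have d0 := mulr_ge0 D_ge0 (ltW eta_gt0).
by move: etaD eta_gt0 => ? ?; apply/andP; split; rewrite /=; lra.
Qed.

Lemma weights_law h : is_law (weights h).
Proof.
elim: h => [|l h IH] /=; first by apply: is_law_uniform; rewrite card_option.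
exact: mw_update_law.
Qed.

Lemma weights_floor h e : rho * eta / #|{: option X}|%:R <= weights h e.
Proof.
case: h => [|l h] /=.
  rewrite -[leRHS]mul1r ler_wpM2r ?invr_ge0//.
  by move: gamma_bd => /andP[_]; lra.
by apply: mw_update_floor => //; apply: weights_law.
Qed.

Lemma weights_gt0 h e : 0 < weights h e.
Proof.
apply: lt_le_trans (weights_floor h e).
by rewrite divr_gt0 ?ltr0n ?card_option//; case/andP: gamma_bd.
Qed.

Lemma combine_law h : is_law (combine h).
Proof.
have [w0 w1] := weights_law h; have [a0 a1] := a_law h.
split=> [x|]; first by rewrite addr_ge0// mulr_ge0.
by rewrite big_split/= -mulr_sumr a1 mulr1 addrC -sum_option.
Qed.

Let S h := \sum_x weights h (Some x).

Let S_bd h : 0 <= S h <= 1.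
Proof.
have [w0 w1] := weights_law h; rewrite sumr_ge0//=.
by rewrite -w1 sum_option lerDr.
Qed.

Lemma weights_move h l :
  l1_dist (weights (l :: h)) (weights h) <= 8 * eta * S h + 2 * (rho * eta).
Proof.
have [w0 _] := weights_law h.
apply: le_trans (mw_update_l1 _ _ _ _ (weights_law h) (excess_bd h l) eta_le gamma_bd) _.
rewrite lerD2r sum_option normr0 mulr0 add0r.
have : \sum_x weights h (Some x) * `|excess h l (Some x)| <= S h * 2.
  rewrite /S mulr_suml; apply: ler_sum => x _; rewrite ler_wpM2l// ler_norml.
  exact: excess_bd.
by move=> h1; have := ler_wpM2l (ltW eta_gt0) h1; lra.
Qed.

Lemma combine_move h l :
  D * l1_dist (combine (l :: h)) (combine h) <=
  D * l1_dist (a (l :: h)) (a h) * weights (l :: h) None +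
  D * l1_dist (weights (l :: h)) (weights h).
Proof.
rewrite -mulrA -mulrDr ler_wpM2l//.
have [a0 a1] := a_law h; have [w0 w1] := weights_law (l :: h).
rewrite /l1_dist sum_option.
rewrite -[X in _ <= _ + (X + _)]mulr1 -a1 mulr_sumr mulr_suml -!big_split/=.
apply: ler_sum => x _; rewrite /combine.
set w' := mw_update _ _ _ _.
have -> : w' (Some x) + w' None * a (l :: h) x - (weights h (Some x) + weights h None * a h x) =
  (a (l :: h) x - a h x) * w' None + ((w' None - weights h None) * a h x +
  (w' (Some x) - weights h (Some x))) by ring.
apply: le_trans (ler_normD _ _) _; rewrite normrM (ger0_norm (w0 None)) lerD2l.
by apply: le_trans (ler_normD _ _) _; rewrite normrM (ger0_norm (a0 x)).
Qed.

Lemma combine_move_le h l b : D * l1_dist (a (l :: h)) (a h) <= b ->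
  D * l1_dist (combine (l :: h)) (combine h) <= b + 10 * (D + 1) * eta.
Proof.
move=> ab; apply: le_trans (combine_move h l) _; apply: lerD.
  have lw := weights_law (l :: h); have := is_law_le1 _ _ None lw; case: lw => w0 _ w1.
  apply: le_trans _ ab; rewrite -[leRHS]mulr1 ler_wpM2l// mulr_ge0//.
  exact: l1_dist_ge0.
have [s0 s1] := andP (S_bd h); have [r0 r1] := andP rho_bd.
have l0 := l1_dist_ge0 _ (weights (l :: h)) (weights h).
apply: (@le_trans _ _ ((D + 1) * l1_dist (weights (l :: h)) (weights h))).
  by rewrite ler_wpM2r// lerDl.
rewrite -mulrA [10 * _]mulrC -mulrA ler_wpM2l ?addr_ge0//.
apply: le_trans (weights_move h l) _.
have := ler_wpM2l (ltW eta_gt0) s1; have := ler_wpM2l (ltW eta_gt0) r1.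
by move: (eta_gt0); lra.
Qed.

(** The multiplicative-weights average uses the weights before [l] is seen, whereas the algorithm
    plays the updated ones. If V is the l1 change of the weights, this drift costs at most 2V and
    the movement D V. By [weights_move], (D+2) V is at most 16 (D+1) eta S, which is the penalty
    contained in the average of [excess], plus the mixing error. *)
Lemma combine_step_cost h l :
  step_cost combine h l <=
  step_cost a h l + \sum_e weights h e * excess h l e + 4 * ((D + 1) * (rho * eta)).
Proof.
have [c0 c2] := andP (base_cost_bd h l).
have [s0 s1] := andP (S_bd h).
have [w'0 w'1] := weights_law (l :: h); have [w0 w1] := weights_law h.
have mv := combine_move h l; have wm := weights_move h l.
have ->  : \sum_e weights h e * excess h l e =
   \sum_x weights h (Some x) * (clip (l x) - step_cost a h l) + 16 * (D + 1) * eta * S h.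
  rewrite sum_option mulr0 add0r /S mulr_sumr -big_split/=.
  by apply: eq_bigr => x _; ring.
have [V VE] : exists V, V = l1_dist (weights (l :: h)) (weights h) by eexists.
have drift : \sum_x weights (l :: h) (Some x) * (clip (l x) - step_cost a h l) <=
   \sum_x weights h (Some x) * (clip (l x) - step_cost a h l) + 2 * V.
  rewrite VE /l1_dist sum_option mulrDr addrCA.
  apply: (@le_trans _ _ (\sum_x (weights h (Some x) * (clip (l x) - step_cost a h l) +
     2 * `|weights (l :: h) (Some x) - weights h (Some x)|))).
    apply: ler_sum => x _; rewrite -lerBlDl -mulrBl.
    apply: le_trans (ler_norm _) _; rewrite normrM mulrC ler_wpM2r//.
    have [d0 d1] := andP (clip_itv (l x)).
    by rewrite ler_norml; apply/andP; split; lra.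
  by rewrite big_split/= -mulr_sumr lerDr mulr_ge0.
(* The movement of [a] is scaled by the updated weight of [None], so it merges with the loss of [a]
   into a share of its whole step cost. *)
have loss : \sum_x combine (l :: h) x * clip (l x) + D * l1_dist (a (l :: h)) (a h) * weights (l :: h) None =
  step_cost a h l + \sum_x weights (l :: h) (Some x) * (clip (l x) - step_cost a h l).
  have -> : \sum_x combine (l :: h) x * clip (l x) =
     \sum_x weights (l :: h) (Some x) * clip (l x) +
     weights (l :: h) None * \sum_x a (l :: h) x * clip (l x).
    rewrite mulr_sumr -big_split; apply: eq_bigr => x _.
    by rewrite {1}/combine mulrDl -mulrA.
  have -> : \sum_x weights (l :: h) (Some x) * (clip (l x) - step_cost a h l) =
     \sum_x weights (l :: h) (Some x) * clip (l x) - S (l :: h) * step_cost a h l.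
    by rewrite /S mulr_suml -sumrB; apply: eq_bigr => x _; ring.
  have -> : S (l :: h) = 1 - weights (l :: h) None.
    by rewrite -w'1 sum_option addrC addrK.
  by rewrite /step_cost; ring.
rewrite {1}/step_cost.
apply: (@le_trans _ _ (step_cost a h l +
    \sum_x weights h (Some x) * (clip (l x) - step_cost a h l) + (D + 2) * V)).
  move: loss drift mv; rewrite -VE.
  set A := \sum_x _ * _; set B := D * _ * _; set A' := \sum_x _ * _; set A'' := \sum_x _ * _.
  by set L := D * l1_dist _ _; lra.
rewrite -!addrA !lerD2l.
have V0 : 0 <= V by rewrite VE l1_dist_ge0.
have := ler_wpM2l D_ge0 wm; rewrite -VE in wm *.
have := mulr_ge0 D_ge0 V0.
have e1 := mulr_ge0 (ltW eta_gt0) s0.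
have e2 := mulr_ge0 D_ge0 e1.
have [g0 _] := andP gamma_bd; have e3 := mulr_ge0 D_ge0 (ltW g0).
by move: (S h) e1 e2 s0 s1 wm => s; lra.
Qed.

Lemma combine_step_regret_base h l :
  step_cost combine h l <= step_cost a h l + 5 * rho +
    (ln (weights (l :: h) None) - ln (weights h None)) / eta.
Proof.
apply: le_trans (combine_step_cost h l) _.
have := mw_update_regret _ _ _ _ (weights_law h) (excess_bd h l) eta_le gamma_bd None
  (weights_gt0 h None).
rewrite -/(weights (l :: h)) [excess _ _ None]/= mulfK ?gt_eqF//.
have r0 : 0 < rho by case/andP: rho_bd.
have := ler_wpM2l (ltW r0) etaD.
set M := \sum_e _; set Q := _ / eta; rewrite expr0n/=; lra.
Qed.

(** The constant 24 is 16 from the penalty plus 8 from the second-order term, as the squared excess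
    is at most 4. *)
Lemma combine_step_regret_state h l x :
  step_cost combine h l <= clip (l x) + 5 * rho + 24 * (D + 1) * eta +
    (ln (weights (l :: h) (Some x)) - ln (weights h (Some x))) / eta.
Proof.
apply: le_trans (combine_step_cost h l) _.
have := mw_update_regret _ _ _ _ (weights_law h) (excess_bd h l) eta_le gamma_bd (Some x)
  (weights_gt0 h (Some x)).
rewrite -/(weights (l :: h)) mulfK ?gt_eqF//.
have r0 : 0 < rho by case/andP: rho_bd.
have := ler_wpM2l (ltW r0) etaD.
have x4 : excess h l (Some x) ^+ 2 <= 4.
  have [x1 x2] := andP (excess_bd h l (Some x)).
  have : 0 <= (2 - excess h l (Some x)) * (2 + excess h l (Some x)) by apply: mulr_ge0; lra.
  by rewrite expr2; lra.
have := ler_wpM2l (ltW eta_gt0) x4.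
rewrite {2}[excess _ _ (Some x)]/=.
have d0 := mulr_ge0 D_ge0 (ltW eta_gt0).
set M := \sum_e _; set Q := _ / eta; set r2 := excess _ _ _ ^+ 2.
by lra.
Qed.

End Step.
End Combine.

(** * All interval lengths at once *)

Fixpoint history {E : Type} (l : nat -> E) (t : nat) : seq E :=
  if t is t'.+1 then l t' :: history l t' else [::].

Section Multiscale.
Context {R : realType} {X : finType}.
Variables (D rho : R) (x0 : X).
Hypothesis D_ge0 : 0 <= D.
Hypothesis rho_bd : 0 < rho <= 1/8.

Fixpoint multiscale (eta : R) (n : nat) : seq (X -> R) -> X -> R :=
  if n is n'.+1 then combine D eta rho (multiscale (eta / 2) n') else constant x0.

Let half_bd (eta : R) : 0 < eta <= (32 * (D + 1))^-1 -> 0 < eta / 2 <= (32 * (D + 1))^-1.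
Proof. by move=> /andP[? ?]; apply/andP; split; lra. Qed.

Let scale_le1 (eta : R) : 0 < eta <= (32 * (D + 1))^-1 -> 20 * (D + 1) * eta <= 1.
Proof.
move=> /andP[e0].
rewrite -[(_)^-1]div1r ler_pdivlMr ?mulr_gt0//; move: D_ge0; last by lra.
by move=> ?; have := mulr_ge0 D_ge0 (ltW e0); lra.
Qed.

(** One level adds 10 (D+1) eta to the movement, and the rates halve inwards, so the total is at
    most twice that. It is below 1, as the next [combine] requires of its base. *)
Lemma multiscale_law_move (eta : R) n : 0 < eta <= (32 * (D + 1))^-1 ->
  (forall h, is_law (multiscale eta n h)) /\
  (forall h l, D * l1_dist (multiscale eta n (l :: h)) (multiscale eta n h) <=
     20 * (D + 1) * eta).
Proof.
elim: n eta => [|n IH] eta eta_bd.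
  split=> [h|h l]; first exact: constant_law.
  have [e0 _] := andP eta_bd.
  by rewrite constant_l1 mulr0 !mulr_ge0 ?addr_ge0// ltW.
have [lawa movea] := IH _ (half_bd _ eta_bd).
have move1 h l : D * l1_dist (multiscale (eta / 2) n (l :: h)) (multiscale (eta / 2) n h) <= 1.
  by apply: le_trans (movea h l) _; apply/scale_le1/half_bd.
split=> [h|h l]; first exact: combine_law.
apply: le_trans (combine_move_le _ D_ge0 _ _ _ eta_bd rho_bd lawa move1 h l _ (movea h l)) _.
by lra.
Qed.

Lemma telescope_ln_le (eta L : R) (w : nat -> R) t0 k :
  0 < eta -> (forall t, 0 < w t <= 1) -> (forall t, - L <= ln (w t)) ->
  \sum_(t0 <= t < t0 + k) (ln (w t.+1) - ln (w t)) / eta <= L / eta.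
Proof.
move=> eta0 w01 wL; rewrite -mulr_suml ler_wpM2r ?invr_ge0 ?(ltW eta0)//.
rewrite telescope_sumr ?leq_addr//.
have := wL t0; have := ln_le0 (proj2 (andP (w01 (t0 + k)%N))); lra.
Qed.

Lemma multiscale_step_cost_le2 (eta : R) n h l : 0 < eta <= (32 * (D + 1))^-1 ->
  step_cost D (multiscale eta n) h l <= 2.
Proof.
move=> eta_bd; have [law1 move1] := multiscale_law_move _ n eta_bd.
have := is_law_mean_bound X _ (clip \o l) _ _ (law1 (l :: h)) (fun x => clip_itv (l x)).
move=> /andP[_ m1]; have := scale_le1 _ eta_bd; have := move1 h l.
by rewrite /step_cost; move: m1 => /=; lra.
Qed.

(** Induction from the outermost, fastest level: the i outer levels are compared with their base,
    the next one with the state [x]. Rates eta, eta/2, ..., eta/2^i contribute L/eta (1 + 2 + ... +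
    2^i). The slowest rate bounds the weight floors of all levels, so a single L serves. *)
Lemma multiscale_regret (L eta : R) n i (l : nat -> X -> R) t0 k x :
  0 < eta <= (32 * (D + 1))^-1 ->
  expR (- L) <= rho * (eta / 2 ^+ n) / #|{: option X}|%:R ->
  (i < n)%N ->
  \sum_(t0 <= t < t0 + k) step_cost D (multiscale eta n) (history l t) (l t) <=
  \sum_(t0 <= t < t0 + k) clip (l t x) + (2 ^+ i.+1 - 1) * (L / eta) +
  k%:R * (i.+1%:R * (5 * rho) + 24 * (D + 1) * (eta / 2 ^+ i)).
Proof.
elim: n i eta => [//|n IH] i eta eta_bd Leta i_lt.
have [lawa movea] := multiscale_law_move _ n (half_bd _ eta_bd).
have move1 h l' : D * l1_dist (multiscale (eta / 2) n (l' :: h)) (multiscale (eta / 2) n h) <= 1.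
  by apply: le_trans (movea h l') _; apply/scale_le1/half_bd.
have [e0 _] := andP eta_bd; have [r0 _] := andP rho_bd.
set a := multiscale (eta / 2) n in lawa movea move1 *.
pose w := weights D eta rho a.
have w01 h e : 0 < w h e <= 1.
  rewrite weights_gt0//=; apply: is_law_le1; exact: weights_law.
have wL h e : - L <= ln (w h e).
  rewrite -[leLHS](@expRK R) ler_ln ?posrE ?expR_gt0//; last by case/andP: (w01 h e).
  apply: le_trans Leta _; apply: le_trans (weights_floor _ D_ge0 _ _ _ eta_bd rho_bd lawa move1 h e).
  rewrite ler_wpM2r ?invr_ge0// ler_wpM2l ?(ltW r0)// ler_piMr ?(ltW e0)//.
  by rewrite invf_le1 ?exprn_gt0// exprn_ege1// ler1n.
have const_sum (c : R) : \sum_(t0 <= t < t0 + k) c = k%:R * c.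
  by rewrite sumr_const_nat addKn mulr_natl.
have tel e : \sum_(t0 <= t < t0 + k)
    (ln (w (history l t.+1) e) - ln (w (history l t) e)) / eta <= L / eta.
  exact: (telescope_ln_le _ _ (fun t => w (history l t) e)).
case: i i_lt => [_|i i_lt].
  apply: (@le_trans _ _ (\sum_(t0 <= t < t0 + k) (clip (l t x) + (5 * rho + 24 * (D + 1) * eta) +
     (ln (w (history l t.+1) (Some x)) - ln (w (history l t) (Some x))) / eta))).
    apply: ler_sum => t _; apply: le_trans (combine_step_regret_state _ D_ge0 _ _ _ eta_bd rho_bd lawa move1 _ _ x) _.
    by rewrite addrA.
  rewrite !big_split/= !const_sum.
  have := tel (Some x).
  rewrite expr1 expr0 divr1 mul1r.
  set A := \sum_(_ <= _ < _) _; set B := \sum_(_ <= _ < _) _; lra.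
have Leta2 : expR (- L) <= rho * (eta / 2 / 2 ^+ n) / #|{: option X}|%:R.
  by rewrite -[eta / 2 / _]mulrA -invfM -exprS.
have := IH i _ (half_bd _ eta_bd) Leta2 i_lt; rewrite -/a => IHa.
apply: (@le_trans _ _ (\sum_(t0 <= t < t0 + k) (step_cost D a (history l t) (l t) + 5 * rho +
     (ln (w (history l t.+1) None) - ln (w (history l t) None)) / eta))).
  by apply: ler_sum => t _; exact: combine_step_regret_base.
rewrite 2!big_split/= const_sum.
have := tel None.
move: IHa; rewrite [L / (eta / 2)](_ : _ = 2 * (L / eta)); last by field; rewrite gt_eqF.
rewrite [eta / 2 / 2 ^+ i](_ : _ = eta / 2 ^+ i.+1); last by rewrite -mulrA -invfM -exprS.
rewrite -[i.+2]addn1 natrD [2 ^+ (i.+1 + 1)]exprD expr1.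
set A := \sum_(_ <= _ < _) _; set B := \sum_(_ <= _ < _) _; set T := \sum_(_ <= _ < _) _. lra.
Qed.

End Multiscale.

(** * Realising laws by maximal couplings *)

Section Coupling.
Context {R : realType} {X : finType}.
Implicit Types p q : X -> R.

(* The maximal coupling: the excess of [p] is spread proportionally to that of *)
(* [q]. If [p = q] the denominator is 0, but so is the numerator.              *)
Definition coupling p q (y x : X) : R :=
  (if x == y then Num.min (p y) (q y) else 0) +
  Num.max 0 (p y - q y) * Num.max 0 (q x - p x) / \sum_z Num.max 0 (q z - p z).

(** The conditional law of the new state given the old one. Where p y = 0 any law would do; q makes
    it a law for every y. *)
Definition kernel p q (y : X) : X -> R := fun x =>
  if p y == 0 then q x else coupling p q y x / p y.

Let pos_ge0 (t : R) : 0 <= Num.max 0 t.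
Proof. by rewrite le_max lexx. Qed.

Lemma sum_pos_parts p q : is_law p -> is_law q ->
  \sum_z Num.max 0 (q z - p z) = \sum_z Num.max 0 (p z - q z).
Proof.
move=> [_ p1] [_ q1]; apply/eqP; rewrite -subr_eq0 -sumrB.
rewrite (eq_bigr (fun z => q z - p z)) => [|z _]; first by rewrite sumrB p1 q1 subrr.
by rewrite /Num.max; case: ltP => ?; case: ltP => ?; lra.
Qed.

(** If the denominator is 0, then so is every positive part, and both sides vanish. *)
Let pos_sum_cancel (f : X -> R) x : 0 <= \sum_z Num.max 0 (f z) ->
  Num.max 0 (f x) * (\sum_z Num.max 0 (f z)) / (\sum_z Num.max 0 (f z)) = Num.max 0 (f x).
Proof.
move=> v0; have [v00|v1] := eqVneq (\sum_z Num.max 0 (f z)) 0; last by rewrite mulfK.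
have : \sum_z Num.max 0 (f z) == 0 by rewrite v00.
rewrite psumr_eq0// => /allP/(_ x (mem_index_enum _))/eqP->.
by rewrite !mul0r.
Qed.

Let min_add_pos (a b : R) : Num.min a b + Num.max 0 (a - b) = a.
Proof. by rewrite /Num.min /Num.max; case: ltP => ?; case: ltP => ?; lra. Qed.

Section Marginals.
Variables p q : X -> R.
Hypotheses (lawp : is_law p) (lawq : is_law q).

Lemma coupling_ge0 y x : 0 <= coupling p q y x.
Proof.
have [[p0 _] [q0 _]] := (lawp, lawq).
apply: addr_ge0; first by case: ifP => // _; rewrite le_min p0 q0.
by rewrite !mulr_ge0// invr_ge0 sumr_ge0.
Qed.

Lemma coupling_marginal_l y : \sum_x coupling p q y x = p y.
Proof.
rewrite big_split/= -big_mkcond big_pred1_eq -mulr_suml -mulr_sumr sum_pos_parts//.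
by rewrite (pos_sum_cancel (fun z => p z - q z)) ?sumr_ge0.
Qed.

Lemma coupling_marginal_r x : \sum_y coupling p q y x = q x.
Proof.
rewrite big_split/= -big_mkcond (eq_bigl (pred1 x)) => [|y]; last by rewrite /= eq_sym.
rewrite big_pred1_eq -!mulr_suml -sum_pos_parts//.
rewrite [X in _ + X / _]mulrC (pos_sum_cancel (fun z => q z - p z)) ?sumr_ge0//.
by rewrite minC min_add_pos.
Qed.

Lemma coupling_kernel y x : p y * kernel p q y x = coupling p q y x.
Proof.
rewrite /kernel; have [py0|py0] := eqVneq (p y) 0; last by rewrite mulrC divfK.
have q0 := lawq.1 y.
rewrite py0 mul0r /coupling py0 sub0r (min_idPl q0) if_same.
by rewrite (max_idPl _) ?oppr_le0// !mul0r addr0.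
Qed.

Lemma kernel_law y : is_law (kernel p q y).
Proof.
rewrite /kernel; have [_|py0] := eqVneq (p y) 0; first by [].
split=> [x|]; first by rewrite mulr_ge0 ?coupling_ge0// invr_ge0; case: lawp.
by rewrite -mulr_suml coupling_marginal_l divff.
Qed.

(** Diagonal mass costs nothing, and the off-diagonal mass v is the sum of the positive parts of q -
    p. *)
Lemma coupling_move_le (c : X -> X -> R) D : (forall x, c x x = 0) ->
  (forall y x, c y x <= D) -> 0 <= D ->
  \sum_y \sum_x coupling p q y x * c y x <= D * l1_dist q p.
Proof.
move=> cxx cD D0; set v := \sum_z Num.max 0 (q z - p z).
apply: (@le_trans _ _ (\sum_y \sum_x Num.max 0 (p y - q y) * Num.max 0 (q x - p x) / v * D)).
  apply: ler_sum => y _; apply: ler_sum => x _; rewrite /coupling mulrDl.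
  have [->|_] := eqVneq x y; last by rewrite mul0r add0r ler_wpM2l// !mulr_ge0// invr_ge0 sumr_ge0.
  by rewrite cxx !mulr0 addr0 !mulr_ge0// invr_ge0 sumr_ge0.
rewrite [leLHS](_ : _ = D * v).
  rewrite ler_wpM2l//; apply: ler_sum => z _.
  by rewrite ge_max normr_ge0 ler_norm.
rewrite -[in RHS](_ : \sum_y Num.max 0 (p y - q y) = v); last by rewrite -sum_pos_parts.
rewrite mulr_sumr; apply: eq_bigr => y _.
rewrite -mulr_suml mulrC; congr (_ * _).
rewrite -mulr_suml -mulr_sumr -/v /v sum_pos_parts//.
by rewrite (pos_sum_cancel (fun z => p z - q z)) ?sumr_ge0.
Qed.

End Marginals.
End Coupling.

(** * The randomized algorithm of a sequence of laws, and its expected cost *)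

Section Online.
Context {R : realType} {M : mts R}.

Lemma diameter_ge0 : 0 <= diameter M.
Proof. exact: bigmax_ge_id. Qed.

Lemma dist_le_diameter (x y : M) : dist x y <= diameter M.
Proof. exact: (le_bigmax _ (fun p : M * M => dist p.1 p.2) (x, y)). Qed.

Variable p : seq (M -> R) -> M -> R.
Hypothesis p_law : forall h, is_law (p h).

(** A Markov strategy: the reversed losses are the history, newest first, and its tail is the
    history that produced the current state. *)
Definition coupled_law (ls : seq (M -> R)) (past : seq M) : M -> R :=
  if past is y :: past' then kernel (p (behead (rev ls))) (p (rev ls)) (last y past')
  else p (rev ls).

Let coupled_law_law ls past : is_law (coupled_law ls past).
Proof. by case: past => [|y past] //=; apply: kernel_law. Qed.

Definition coupled_algorithm : online_algorithm M :=
  OnlineAlgorithm (fun ls past => (coupled_law_law ls past).1)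
    (fun ls past => (coupled_law_law ls past).2).

Local Notation A := coupled_algorithm.
Local Notation D := (diameter M).

Variables (x0 : M) (ls : seq (M -> R)).
Local Notation l := (nth (fun=> 0) ls).

Lemma rev_take_history t : (t <= size ls)%N -> rev (take t ls) = history l t.
Proof.
elim: t => [|t IH] tls; first by rewrite take0.
by rewrite (take_nth (fun=> 0)) ?rev_rcons ?IH// ltnW.
Qed.

(** Expectation over prefixes of length n, so that one can induct on time; [path_meanS] conditions
    on all but the last state. *)
Definition path_mean n (F : seq M -> R) : R :=
  \sum_(w : n.-tuple M)
    (\prod_(t < n) A (take t.+1 ls) (take t w) (nth x0 w t)) * F w.

Lemma path_meanS n F : path_mean n.+1 F =
  path_mean n (fun w => \sum_x A (take n.+1 ls) w x * F (rcons w x)).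
Proof.
rewrite /path_mean.
have bij : bijective (fun wx : n.-tuple M * M => [tuple of rcons wx.1 wx.2]).
  apply: inj_card_bij; last by rewrite card_prod !card_tuple expnSr.
  by move=> [w x] [w' x'] /(congr1 val)/= /rcons_inj[/val_inj-> ->].
rewrite (reindex _ (onW_bij _ bij))/=.
under [RHS]eq_bigr do rewrite mulr_sumr.
rewrite pair_bigA/=; apply: eq_bigr => -[w x] _ /=.
rewrite big_ord_recr/= mulrA; congr (_ * _ * _).
  apply: eq_bigr => t _; rewrite -cats1 takel_cat ?size_tuple 1?ltnW//.
  by rewrite nth_cat size_tuple ltn_ord.
rewrite -cats1 takel_cat ?size_tuple// [take n w]take_oversize ?size_tuple//.
by rewrite nth_cat size_tuple ltnn subnn.
Qed.

Lemma eq_path_mean n F G : (forall w : seq M, size w = n -> F w = G w) ->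
  path_mean n F = path_mean n G.
Proof. by move=> FG; apply: eq_bigr => w _; rewrite FG ?size_tuple. Qed.

Lemma path_meanD n F G :
  path_mean n (fun w => F w + G w) = path_mean n F + path_mean n G.
Proof. by rewrite -big_split/=; apply: eq_bigr => w _; rewrite mulrDr. Qed.

Let coupled_lawS n (w : seq M) x : (n.+1 < size ls)%N -> size w = n.+1 ->
  A (take n.+2 ls) w x = kernel (p (history l n.+1)) (p (history l n.+2)) (last x0 w) x.
Proof. by case: w => //= y w nls _; rewrite /coupled_law rev_take_history. Qed.

(** The kernel carries each law to the next, by the second marginal of the coupling. *)
Lemma path_mean_last n f : (n < size ls)%N ->
  path_mean n.+1 (fun w => f (last x0 w)) = \sum_x p (history l n.+1) x * f x.
Proof.
elim: n f => [|n IH] f nls; rewrite path_meanS.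
  rewrite /path_mean (big_pred1 [tuple])/=; last by case=> [[|? ?]].
  by rewrite big_ord0 mul1r /= rev_take_history.
pose g y := \sum_x kernel (p (history l n.+1)) (p (history l n.+2)) y x * f x.
rewrite (eq_path_mean _ _ (fun w => g (last x0 w))); last first.
  by move=> w wn; apply: eq_bigr => x _; rewrite coupled_lawS// last_rcons.
rewrite IH; last exact: ltnW.
under eq_bigr do rewrite /g mulr_sumr.
rewrite exchange_big/=; apply: eq_bigr => x _.
under eq_bigr do rewrite mulrA coupling_kernel//.
by rewrite -mulr_suml coupling_marginal_r.
Qed.

Lemma path_mean_move_le n : (n.+1 < size ls)%N ->
  path_mean n.+1 (fun w => \sum_x A (take n.+2 ls) w x * dist x (last x0 w)) <=
  D * l1_dist (p (history l n.+2)) (p (history l n.+1)).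
Proof.
move=> nls.
pose g y := \sum_x kernel (p (history l n.+1)) (p (history l n.+2)) y x * dist x y.
rewrite (eq_path_mean _ _ (fun w => g (last x0 w))); last first.
  by move=> w wn; apply: eq_bigr => x _; rewrite coupled_lawS.
rewrite path_mean_last 1?ltnW//.
have := coupling_move_le _ _ (p_law (history l n.+1)) (p_law (history l n.+2))
  (fun y x => dist x y) D (fun x => distxx x) (fun y x => dist_le_diameter x y) diameter_ge0.
apply: le_trans; apply: ler_sum => y _; rewrite /g mulr_sumr.
by apply: ler_sum => x _; rewrite mulrA coupling_kernel.
Qed.

Variables t0 k : nat.
Hypothesis clip_ls : forall t x, (t < size ls)%N -> clip (l t x) = l t x.

Definition prefix_cost n (w : seq M) : R :=
  \sum_(0 <= t < n | (t0 <= t < t0 + k)%N) l t (nth x0 w t) +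
  \sum_(0 <= t < n | (t0 < t < t0 + k)%N) dist (nth x0 w t) (nth x0 w t.-1).

Lemma path_mean_prefix_cost_le n : (n <= size ls)%N ->
  path_mean n (prefix_cost n) <=
  \sum_(0 <= t < n | (t0 <= t < t0 + k)%N) step_cost D p (history l t) (l t).
Proof.
elim: n => [|n IH] nls.
  rewrite big_geq// /path_mean big1// => w _.
  by rewrite /prefix_cost !big_geq// addr0 mulr0.
have costS w x : size w = n -> prefix_cost n.+1 (rcons w x) = prefix_cost n w +
    ((if (t0 <= n < t0 + k)%N then l n x else 0) +
     (if (t0 < n < t0 + k)%N then dist x (last x0 w) else 0)).
  move=> wn; rewrite /prefix_cost big_mkcond big_nat_recr//= [X in _ + _ + X = _]big_mkcond.
  rewrite [X in _ + _ + X = _]big_nat_recr//= -!big_mkcond/= nth_rcons wn ltnn eqxx.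
  rewrite addrACA; congr (_ + _ + (_ + _)).
  - rewrite [LHS]big_nat_cond [RHS]big_nat_cond; apply: eq_bigr => t /andP[/andP[_ tn] _].
    by rewrite nth_rcons wn tn.
  - rewrite [LHS]big_nat_cond [RHS]big_nat_cond; apply: eq_bigr => t /andP[/andP[_ tn] _].
    by rewrite !nth_rcons wn tn (leq_ltn_trans (leq_pred t) tn).
  - case: ifP => // /andP[t0n _]; rewrite nth_rcons wn.
    have n0 : (0 < n)%N by apply: leq_ltn_trans t0n.
    by rewrite prednK// leqnn -wn nth_last.
rewrite path_meanS.
rewrite (eq_path_mean _ _ (fun w => prefix_cost n w +
   ((if (t0 <= n < t0 + k)%N then \sum_x A (take n.+1 ls) w x * l n x else 0) +
    (if (t0 < n < t0 + k)%N then \sum_x A (take n.+1 ls) w x * dist x (last x0 w) else 0)))); last first.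
  move=> w wn; under eq_bigr do rewrite costS//.
  move: (prefix_cost n w) => c; under eq_bigr do rewrite !mulrDr.
  rewrite !big_split/= -mulr_suml (coupled_law_law _ _).2 mul1r; congr (_ + (_ + _)).
    by case: (t0 <= n < t0 + k)%N => //; rewrite big1// => x _; rewrite mulr0.
  by case: (t0 < n < t0 + k)%N => //; rewrite big1// => x _; rewrite mulr0.
rewrite path_meanD [X in _ + X <= _]path_meanD [leRHS]big_mkcond [leRHS]big_nat_recr//= -[X in _ <= X + _]big_mkcond/=.
apply: lerD; first by apply: IH; apply: ltnW.
have mean0 m : path_mean m (fun=> 0) = 0.
  by rewrite /path_mean big1// => w _; rewrite mulr0.
case: (boolP (t0 <= n < t0 + k)%N) => [/andP[t0n nk]|nI]; last first.
  rewrite (_ : (t0 < n < t0 + k)%N = false) ?mean0 ?addr0//.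
  by apply: contraNF nI => /andP[/ltnW-> ->].
rewrite /step_cost; apply: lerD.
  rewrite (eq_path_mean _ _ (fun w => \sum_x A (take n.+1 ls) w x * l n (last x0 (rcons w x)))); last first.
    by move=> w _; apply: eq_bigr => x _; rewrite last_rcons.
  rewrite -(path_meanS n (fun w => l n (last x0 w))) path_mean_last//.
  by apply: ler_sum => x _; rewrite clip_ls.
(* At the first step of the interval no movement is charged, and the l1 term is merely
   nonnegative. *)
rewrite nk andbT; case: (ltnP t0 n) => [t0n'|_]; last by rewrite mean0 mulr_ge0 ?diameter_ge0 ?l1_dist_ge0.
by case: n nls t0n' {IH costS t0n nk} => // m mls _; apply: path_mean_move_le.
Qed.

End Online.

Lemma expected_cost_le (R : realType) (M : mts R) (p : seq (M -> R) -> M -> R)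
    (p_law : forall h, is_law (p h)) T (l : T.-tuple (M -> R)) t0 k :
  (t0 + k <= T)%N -> (forall t x, 0 <= tnth l t x <= 1) ->
  expected (coupled_algorithm p p_law) l (cost t0 k l) <=
  \sum_(t0 <= t < t0 + k) step_cost (diameter M) p (history (nth (fun=> 0) l) t) (nth (fun=> 0) l t).
Proof.
move=> tkT l01; have /card_gt0P[x0 _] := state_gt0 M.
have clipl t x : (t < size l)%N -> clip (nth (fun=> 0) l t x) = nth (fun=> 0) l t x.
  rewrite size_tuple => tT; apply: clip_id.
  by rewrite -(tnth_nth _ l (Ordinal tT)).
have := path_mean_prefix_cost_le p p_law x0 l t0 k clipl T; rewrite size_tuple => /(_ (leqnn T)).
have -> : path_mean p p_law x0 l T (prefix_cost x0 l t0 k T) =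
    expected (coupled_algorithm p p_law) l (cost t0 k l).
  apply: eq_bigr => w _; congr (_ * _).
    by apply: eq_bigr => t _; rewrite (tnth_nth x0).
  rewrite /prefix_cost /cost !big_mkord; congr (_ + _).
    by apply: eq_bigr => t _; rewrite !(tnth_nth x0) (tnth_nth (fun=> 0)).
  apply: eq_bigr => t /andP[t0t _]; rewrite !(tnth_nth x0)/=.
  congr (dist _ (nth _ _ _)); case: (t : nat) (ltn_ord t) t0t => // m mT _.
  by rewrite addSn/= modnDr modn_small// ltnW.
move=> /le_trans; apply.
rewrite [leRHS](big_nat_widen _ _ _ _ _ tkT) [leRHS](big_nat_widenl _ _ _ _ _ (leq0n t0)).
by under [leRHS]eq_bigl do rewrite /= andbC.
Qed.

(** * Tuning *)

Lemma regret_le_of_step_cost (R : realType) (M : mts R)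
    (p : seq (M -> R) -> M -> R) (p_law : forall h, is_law (p h)) T t0 k r :
  (t0 + k <= T)%N ->
  (forall (l : nat -> M -> R) x, (forall t y, 0 <= l t y <= 1) ->
     \sum_(t0 <= t < t0 + k) step_cost (diameter M) p (history l t) (l t) <=
     \sum_(t0 <= t < t0 + k) l t x + r) ->
  (regret (coupled_algorithm p p_law) T t0 k <= r%:E)%E.
Proof.
move=> tkT pr; apply: ereal_inf_lbound; exists r => // l l_losses.
have l01 t x : 0 <= tnth l t x <= 1 by have := losses_01 (l_losses t); apply.
(* Beyond the horizon the losses are extended by 0, which is still in [0,1]. *)
have nth01 t x : 0 <= nth (fun=> 0) l t x <= 1.
  have [tT|tT] := ltnP t T; first by rewrite -(tnth_nth _ l (Ordinal tT)).
  by rewrite nth_default ?size_tuple// lexx ler01.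
apply: le_trans (expected_cost_le R M p p_law T l t0 k tkT l01) _.
rewrite -lerBlDr; apply: lb_le_inf.
  by have /card_gt0P[x _] := state_gt0 M; exists (\sum_(t < T | (t0 <= t < t0 + k)%N) tnth l t x), x.
move=> _ [x _ <-]; rewrite lerBlDr.
have -> : \sum_(t < T | (t0 <= t < t0 + k)%N) tnth l t x =
    \sum_(t0 <= t < t0 + k) nth (fun=> 0) l t x.
  rewrite (big_nat_widen _ _ _ _ _ tkT) (big_nat_widenl _ _ _ _ _ (leq0n t0)) big_mkord.
  by apply: eq_big => t; [rewrite /= andbC | rewrite (tnth_nth (fun=> 0))].
exact: pr.
Qed.

Lemma ln_nat_ge_half (R : realType) n : (2 <= n)%N -> 1/2 <= ln (n%:R : R).
Proof.
move=> n2; have n0 : 0 < n%:R :> R by rewrite ltr0n ltnW.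
have := ln_le_subr1 _ (n%:R : R)^-1; rewrite invr_gt0 n0 => /(_ isT).
rewrite lnV ?posrE//.
have : (n%:R : R)^-1 <= 2^-1 by rewrite lef_pV2 ?posrE// ler_nat.
lra.
Qed.

Lemma multiscale_tuned_regret (R : realType) (X : finType) (D : R) (x0 x : X)
    (T t0 k : nat) (l : nat -> X -> R) :
  0 <= D -> (2 <= #|X|)%N -> D + 1 < T%:R -> (1 <= k)%N -> (t0 + k <= T)%N ->
  \sum_(t0 <= t < t0 + k)
    step_cost D (multiscale D (8 * T%:R ^+ 2)^-1 x0 (32 * (D + 1))^-1 (up_log 2 T).+1)
      (history l t) (l t) <=
  \sum_(t0 <= t < t0 + k) clip (l t x) +
  2000 * Num.sqrt ((D + 1) * k%:R * ln (#|X| * T)%:R).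
Proof.
move=> D0 N2 DT k1 tkT.
set K := D + 1 in DT *; have K1 : 1 <= K by rewrite /K; lra.
have K0 : 0 < K by lra.
have T2 : (2 <= T)%N by rewrite -(ltr_nat R); lra.
have T2R : 2 <= T%:R :> R by rewrite ler_nat.
have T0R : 0 < T%:R :> R by lra.
have kT : (k <= T)%N by apply: leq_trans tkT; apply: leq_addl.
have kTR : k%:R <= T%:R :> R by rewrite ler_nat.
have k1R : 1 <= k%:R :> R by rewrite ler1n.
set lam := ln _; have lam2 : 1/2 <= lam.
  by apply: ln_nat_ge_half; rewrite (leq_trans N2)// leq_pmulr// ltnW.
set J := up_log 2 T.
have /andP[JT1 JT2] : (2 ^ J.-1 < T <= 2 ^ J)%N by apply: up_log_bounds.
have J0 : (0 < J)%N by case: (J) JT2 => //; rewrite expn0 leqNgt T2.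
have J2T : (2 ^ J <= 2 * T)%N by rewrite -(prednK J0) expnS leq_mul2l ltnW.
have KL0 : 0 < K * lam by rewrite mulr_gt0//; lra.
set s := Num.sqrt _.
have sE : s ^+ 2 = K * k%:R * lam by rewrite sqr_sqrtr// !mulr_ge0//; lra.
have s0 : 0 <= s by apply: sqrtr_ge0.
have sge (y : R) : y ^+ 2 <= K * k%:R * lam -> y <= s.
  move=> ys; apply: le_trans (ler_norm y) _; rewrite -sqrtr_sqr.
  exact: ler_wsqrtr.
set eta := (32 * K)^-1; set rho := (8 * T%:R ^+ 2)^-1.
have eta_bd : 0 < eta <= (32 * (D + 1))^-1 by rewrite lexx invr_gt0 mulr_gt0.
have rho_bd : 0 < rho <= 1/8.
  rewrite invr_gt0 mulr_gt0 ?exprn_gt0//=.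
  rewrite div1r lef_pV2 ?posrE ?mulr_gt0 ?exprn_gt0//.
  by rewrite ler_peMr// exprn_ege1//; lra.
have bracketJ : k%:R <= 4 ^+ J * (K * lam).
  apply: (@le_trans _ _ (T%:R ^+ 2 * (1 * 1/2))).
    by rewrite expr2; nra.
  apply: ler_pM; rewrite ?exprn_ge0//; try lra.
    rewrite (_ : 4 = 2 ^+ 2) -?exprM 1?mulnC ?exprM//.
      by rewrite lerXn2r ?nnegrE ?exprn_ge0// -natrX ler_nat.
    by rewrite expr2; ring.
  by rewrite -mulrA ler_pM//; lra.
(* The least such i balances the two terms. If i = 0 then k <= s, and a cost of 2 per step suffices;
   otherwise k lies between consecutive values of 4^i K lam. *)
have bracket : exists i, k%:R <= 4 ^+ i * (K * lam) by exists J.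
case: (ex_minnP bracket) => i ik imin.
case: i ik imin => [|j] ik imin.
  apply: (@le_trans _ _ (\sum_(t0 <= t < t0 + k) (2 : R))).
    by apply: ler_sum => t _; apply: multiscale_step_cost_le2.
  rewrite sumr_const_nat addKn -mulr_natr.
  have : k%:R <= s.
    by apply: sge; move: ik; rewrite expr0 mul1r expr2 => ik; nra.
  have : 0 <= \sum_(t0 <= t < t0 + k) clip (l t x).
    by apply: sumr_ge0 => t _; case/andP: (clip_itv (l t x)).
  lra.
have jk : 4 ^+ j * (K * lam) < k%:R.
  by rewrite ltNge; apply/negP => /imin; rewrite ltnn.
have iJ : (j < J)%N by apply: imin.
(* All weights are at least (NT)^-10: use K <= T, 2^(J+1) <= 4T, N + 1 <= 2N, and (NT)^6 >= 4^6 to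
   absorb the constant 2048. *)
have Leta : expR (- (10 * lam)) <= rho * (eta / 2 ^+ J.+1) / #|{: option X}|%:R.
  have N0 : (0 < #|X| * T)%N by rewrite muln_gt0 (ltnW N2) (ltnW T2).
  have n0 : 0 < (#|X| * T)%:R :> R by rewrite ltr0n.
  rewrite expRN (_ : 10 * lam = ln ((#|X| * T)%:R ^+ 10)); last by rewrite lnXn// mulr_natl.
  rewrite lnK ?posrE ?exprn_gt0// -natrX /rho /eta card_option -!invfM lef_pV2 ?posrE; last first.
  - by rewrite !mulr_gt0 ?exprn_gt0.
  - by rewrite ltr0n expn_gt0 N0.
  apply: (@le_trans _ _ (8 * T%:R ^+ 2 * (32 * T%:R * (4 * T%:R)) * (2 * #|X|%:R))).
    apply: ler_pM => //; rewrite ?mulr_ge0 ?exprn_ge0 ?ler0n//; try exact: ltW; last first.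
      by rewrite -natrM ler_nat mul2n -addnn -addn1 leq_add2l ltnW.
    apply: ler_wpM2l; first by rewrite mulr_ge0 ?exprn_ge0 ?ler0n.
    apply: ler_pM; rewrite ?mulr_ge0 ?exprn_ge0 ?ler0n//; try exact: ltW.
      by rewrite ler_wpM2l// ltW.
    by rewrite -natrX -natrM ler_nat expnS -(mulnA 2 2) leq_mul2l.
  rewrite -!natrX -!natrM ler_nat.
  have -> : (8 * T ^ 2 * (32 * T * (4 * T)) * (2 * #|X|) = 4 ^ 5 * 2 * (#|X| * T ^ 4))%N.
    by ring.
  have -> : ((#|X| * T) ^ 10 = (#|X| * T) ^ 6 * (#|X| ^ 4 * T ^ 4))%N.
    by rewrite -expnMn -expnD.
  apply: leq_mul; first apply: (@leq_trans (4 ^ 6)) => //.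
    by rewrite leq_exp2r// (leq_mul N2 T2).
  by rewrite leq_mul2r -{1}[#|X|]expn1 leq_pexp2l ?orbT// ltnW.
apply: le_trans (multiscale_regret D rho x0 D0 rho_bd (10 * lam) eta J.+1 j.+1 l t0 k x eta_bd Leta _) _.
  exact: iJ.
rewrite -addrA lerD2l.
have four : 4 ^+ j = 2 ^+ j * 2 ^+ j :> R by rewrite -exprMn; congr (_ ^+ _); ring.
have p0 : 0 < 2 ^+ j :> R by rewrite exprn_gt0.
(* [h1] bounds the geometric sum, [h2] the per-step term of the chosen rate, and [h3] with [h4] the
   mixing error. *)
have h1 : 2 ^+ j * (K * lam) <= s.
  apply: sge; rewrite exprMn expr2 -four expr2.
  have := ler_wpM2r (ltW KL0) (ltW jk); lra.
have h2 : k%:R / 2 ^+ j.+1 <= s.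
  apply: sge; rewrite expr_div_n ler_pdivrMr ?exprn_gt0//.
  rewrite -exprM mulnC exprM (_ : 2 ^+ 2 = 4 :> R); last by rewrite expr2; ring.
  have := ler_wpM2l (ltW (lt_le_trans ltr01 k1R)) ik; rewrite expr2; lra.
have h3 : k%:R * (j.+2%:R * (5 * rho)) <= 5/4.
  have j2 : j.+2%:R <= 2 * T%:R :> R.
    by rewrite -natrM ler_nat (leq_trans _ J2T)// (leq_trans _ (ltn_expl J (ltnSn 1))).
  rewrite (_ : k%:R * _ = j.+2%:R * k%:R * 5 * rho); last by ring.
  rewrite /rho ler_pdivrMr ?mulr_gt0 ?exprn_gt0//.
  have := ler_pM (ler0n R j.+2) (ler0n R k) j2 kTR; rewrite expr2; lra.
have h4 : 1/2 <= s by apply: sge; rewrite expr2; nra.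
have -> : 10 * lam / eta = 320 * (K * lam) by rewrite /eta invrK; ring.
have -> : 24 * (D + 1) * (eta / 2 ^+ j.+1) = 3/4 / 2 ^+ j.+1.
  by rewrite -/K /eta; field; rewrite !gt_eqF// exprn_gt0.
rewrite mulrDr [k%:R * (3/4 / _)]mulrCA [2 ^+ j.+2]exprS [2 ^+ j.+1]exprS in h2 *.
lra.
Qed.

Theorem corollary2p3 (R : realType) :
  exists2 C : R, 0 < C &
    forall (M : mts R) (T : nat), (1 <= T)%N ->
    exists A : online_algorithm M,
    forall t0 k : nat, (1 <= k)%N -> (t0 + k <= T)%N ->
      (regret A T t0 k <=
        (C * Num.sqrt ((diameter M + 1) * k%:R * ln (#|M| * T)%:R))%:E)%E.
Proof.
exists 2000; first by rewrite ltr0n.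
move=> M T T1.
have /card_gt0P[x0 _] := state_gt0 M.
have D0 := @diameter_ge0 R M; set D := diameter M in D0 *.
have bound_ge0 k : 0 <= 2000 * Num.sqrt ((D + 1) * k%:R * ln (#|M| * T)%:R).
  by rewrite mulr_ge0 ?ler0n ?sqrtr_ge0.
have [N1|N2] := leqP #|M| 1.
  exists (coupled_algorithm _ (constant_law x0)) => t0 k k1 tkT.
  apply: regret_le_of_step_cost => // l x l01; rewrite -[leLHS]addr0 lerD//.
  apply: ler_sum => t _; rewrite constant_step_cost clip_id//.
  by rewrite (card_le1_eqP N1 x x0).
(* When T <= D + 1, never moving is good enough: its regret is at most k, and k <= D + 1 gives k/2
   <= s. *)
have [TD|DT] := leP T%:R (D + 1).
  exists (coupled_algorithm _ (constant_law x0)) => t0 k k1 tkT.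
  apply: regret_le_of_step_cost => // l x l01.
  apply: (@le_trans _ _ (\sum_(t0 <= t < t0 + k) (1 : R))).
    by apply: ler_sum => t _; rewrite constant_step_cost clip_id//; case/andP: (l01 t x0).
  rewrite sumr_const_nat addKn -[leLHS]add0r lerD//.
    by apply: sumr_ge0 => t _; case/andP: (l01 t x).
  have kT : k%:R <= T%:R :> R by rewrite ler_nat; apply: leq_trans tkT; apply: leq_addl.
  have lam2 : 1/2 <= ln (#|M| * T)%:R :> R.
    by apply: ln_nat_ge_half; rewrite (leq_trans N2)// leq_pmulr.
  set s := Num.sqrt _; suff : k%:R / 2 <= s by have := ler0n R k; lra.
  rewrite -[leLHS]ger0_norm ?divr_ge0// -sqrtr_sqr ler_wsqrtr// expr_div_n ler_pdivrMr ?exprn_gt0//.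
  have k0 := ler0n R k; have D1 : 0 <= D + 1 by lra.
  have Dk := mulr_ge0 D1 k0; have := ler_wpM2l Dk lam2.
  have := ler_wpM2l k0 (le_trans kT TD).
  rewrite !expr2; lra.
have eta_bd : 0 < (32 * (D + 1))^-1 <= (32 * (D + 1))^-1.
  by rewrite lexx invr_gt0 mulr_gt0//; lra.
have rho_bd : 0 < (8 * T%:R ^+ 2 : R)^-1 <= 1/8.
  have T1R : 1 <= T%:R :> R by rewrite ler1n.
  have T0R : 0 < T%:R :> R by lra.
  rewrite invr_gt0 mulr_gt0 ?exprn_gt0//=.
  rewrite div1r lef_pV2 ?posrE ?mulr_gt0 ?exprn_gt0//.
  by rewrite ler_peMr// exprn_ege1.
exists (coupled_algorithm _ (multiscale_law_move _ _ x0 D0 rho_bd _ (up_log 2 T).+1 eta_bd).1).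
move=> t0 k k1 tkT; apply: regret_le_of_step_cost => // l x l01.
apply: le_trans (multiscale_tuned_regret _ _ _ x0 x _ _ _ l D0 N2 DT k1 tkT) _.
by rewrite lerD2r; apply: ler_sum => t _; rewrite clip_id.
Qed.
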